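(* Let $k\in\mathbb N_0$. For every integer $L\ge0$, \[ S_L^{k+1}=\bigoplus_{m=0}^{L}Y_m^{k+1} \] (as a direct sum of vector spaces).
   Context: $\mathbb N_0=\{0,1,2,\dots\}$. $\mathbb P_r(K)$ denotes polynomials of degree at most $r$ on the interval $K$. $\mathcal T_m$ is the uniform dyadic partition of $(0,1)$ into $2^m$ cells. $S_m^{k+1}=\{v\in C^0([0,1]):v|_K\in\mathbb P_{k+1}(K)\ \forall K\in\mathcal T_m\}$. For $m\ge1$ and $K=[a_K,b_K]\in\mathcal T_{m-1}$, split into its two halves $K_L,K_R$, let $Z_K^k=\{z\in L^2(K):z|_{K_L}\in\mathbb P_k(K_L),\ z|_{K_R}\in\mathbb P_k(K_R),\ \int_Kzq\,\mathrm dx=0\ \forall q\in\mathbb P_k(K)\}$, which has dimension $k+1$, and let $\{\psi_{m,K,r}^k\}_{r=0}^k$ be an $L^2(K)$-orthonormal basis of $Z_K^k$ (extended by zero outside $K$). Define $\theta_{m,K,r}^{k+1}(x)=\int_{a_K}^x\psi_{m,K,r}^k(s)\,\mathrm ds$ for $x\in K$ and $\theta_{m,K,r}^{k+1}(x)=0$ for $x\notin K$. Set $Y_m^{k+1}=\operatorname{span}\{\theta_{m,K,r}^{k+1}:K\in\mathcal T_{m-1},\ 0\le r\le k\}$ for $m\ge1$, and $Y_0^{k+1}=S_0^{k+1}$ (equivalently, $Y_0^{k+1}$ is spanned by the constant $1$ and the primitives $\int_0^x\psi_{0,r}^k(s)\,\mathrm ds$ of an orthonormal basis $\{\psi_{0,r}^k\}_{r=0}^k$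 of $\mathbb P_k([0,1])$). *)

(* Defs.v *)
From HB Require Import structures.
From mathcomp Require Import all_boot all_order all_algebra.
From mathcomp Require Import all_classical all_reals all_analysis.
Import Order.TTheory GRing.Theory Num.Theory.
Import numFieldNormedType.Exports.

Set Implicit Arguments.
Unset Strict Implicit.
Unset Printing Implicit Defensive.

Local Open Scope classical_set_scope.
Local Open Scope ring_scope.

Definition family_span (K : pzRingType) (V : lmodType K) (I : finType)
    (F : I -> V) : set V :=
  [set v | exists c : I -> K, v = \sum_(i : I) c i *: F i].

Definition is_direct_sum (K : pzRingType) (V : lmodType K) (n : nat)
    (S : set V) (W : 'I_n -> set V) : Prop :=
  [/\ forall i, submod_closed (mem (W i)),
      S = [set v | exists2 w : 'I_n -> V,
                     forall i, W i (w i) & v = \sum_(i < n) w i] &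
      forall w : 'I_n -> V, (forall i, W i (w i)) ->
        \sum_(i < n) w i = 0 -> forall i, w i = 0].

Section MultiscaleSpaces.
Context {R : realType}.

Local Notation mu := (@lebesgue_measure R).

(* The cells of the dyadic partition T_m are [j / 2^m, (j+1) / 2^m] for
   j < 2^m. *)
Definition cell_left (m : nat) (j : 'I_(2 ^ m)) : R := j%:R / (2 ^ m)%:R.
Definition cell_right (m : nat) (j : 'I_(2 ^ m)) : R := j.+1%:R / (2 ^ m)%:R.

(* Functions on a compact interval are represented by functions on the whole
   line that vanish outside it, so that equality of representatives is equality
   on the interval. *)
Definition supported_in (a b : R) (v : R -> R) : Prop :=
  forall x : R, x \notin `[a, b] -> v x = 0.

(* [spline m r] is S_m^r: degree at most r means [size p <= r.+1]. The scalar
   action of R on itself lives on the alias R^o. *)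
Definition spline (m r : nat) : set (R -> R^o) :=
  [set v : R -> R | [/\ supported_in 0 1 v,
    {within `[0, 1], continuous v} &
    forall j : 'I_(2 ^ m), exists2 p : {poly R}, (size p <= r.+1)%N &
      forall x : R, x \in `[cell_left j, cell_right j] -> v x = p.[x] ]].

(* Elements of L^2 are represented by square-integrable functions, and
   conditions on them are imposed almost everywhere. *)
Definition L2 (a b : R) : set (R -> R) :=
  [set z : R -> R | z \in Lfun mu 2%:E /\ supported_in a b z].

Definition L2dot (a b : R) (y z : R -> R) : R :=
  \int[mu]_(x in `[a, b]) (y x * z x).

Definition ae_poly (k : nat) (a b : R) (z : R -> R) : Prop :=
  exists2 p : {poly R}, (size p <= k.+1)%N &
    {ae mu, forall x : R, x \in `[a, b] -> z x = p.[x]}.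

Definition Zspace (k : nat) (a b : R) : set (R -> R) :=
  [set z | [/\ L2 a b z,
    ae_poly k a ((a + b) / 2) z,
    ae_poly k ((a + b) / 2) b z &
    forall q : {poly R}, (size q <= k.+1)%N -> L2dot a b z (horner q) = 0]].

Definition L2_orthonormal_basis (a b : R) (n : nat) (Z : set (R -> R))
    (psi : 'I_n -> R -> R) : Prop :=
  [/\ forall r, Z (psi r),
      forall r s, L2dot a b (psi r) (psi s) = (r == s)%:R &
      forall z, Z z -> exists c : 'I_n -> R,
        {ae mu, forall x : R, z x = \sum_(r < n) c r * psi r x}].

Definition primitive_on (a b : R) (psi : R -> R) : R -> R^o :=
  fun x => if x \in `[a, b] then \int[mu]_(s in `[a, x]) psi s else 0.

(* In [psi m j r], the index j refers to the cell K of the partition T_(m-1);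
   the family is only used for m >= 1. *)
Definition theta (k : nat)
    (psi : forall m : nat, 'I_(2 ^ m.-1) -> 'I_k.+1 -> R -> R)
    (m : nat) (jr : 'I_(2 ^ m.-1) * 'I_k.+1) : R -> R^o :=
  primitive_on (cell_left jr.1) (cell_right jr.1) (psi m jr.1 jr.2).

Definition Yspace (k : nat)
    (psi : forall m : nat, 'I_(2 ^ m.-1) -> 'I_k.+1 -> R -> R)
    (m : nat) : set (R -> R^o) :=
  if m == 0%N then spline 0 k.+1 else family_span (@theta k psi m).

End MultiscaleSpaces.

(* Main.v *)
(* Differentiation turns a spline of degree k+1 into a piecewise polynomial of
   degree k, and it intertwines the splitting of S_(m+1) into S_m and Y_(m+1)
   with the L^2-orthogonal splitting of the piecewise polynomials on the halves
   of each cell K of T_m into P_k(K) and Z_K. Existence: on K, let g be the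
   L^2(K)-projection of v' onto P_k(K); then v' - g lies in Z_K, and its
   primitive, which vanishes at both endpoints of K, is a combination of the
   theta's; what remains of v is a single polynomial on K. Uniqueness: a
   combination of the theta's that is a polynomial p on K has p' in Z_K, so p'
   is orthogonal to itself; hence p is constant and, vanishing at the left
   endpoint, zero. *)

From HB Require Import structures.
Require Import Defs.
From mathcomp Require Import all_boot all_order all_algebra.
From mathcomp Require Import all_classical all_reals all_analysis.
From mathcomp Require Import measurable_realfun ring lra.
From mathcomp Require polyrcf.
Import Order.TTheory GRing.Theory Num.Theory.
Import numFieldNormedType.Exports.

Set Implicit Arguments.
Unset Strict Implicit.
Unset Printing Implicit Defensive.

Local Open Scope classical_set_scope.
Local Open Scope ring_scope.

(** * Formal integration of polynomials and the pairing it induces on them *)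

Section PolynomialIntegral.
Context {R : realType}.
Implicit Types (p q : {poly R}) (a b c x : R).

(* Division by zero gives zero, so the constant coefficient vanishes. *)
Definition antideriv p : {poly R} := \poly_(i < (size p).+1) (p`_i.-1 / i%:R).

Lemma coef_antideriv p i : (antideriv p)`_i = p`_i.-1 / i%:R.
Proof.
rewrite coef_poly; case: ltnP => //; case: i => [//|i] /= lei.
by rewrite nth_default ?mul0r.
Qed.

Lemma size_antideriv p : (size (antideriv p) <= (size p).+1)%N.
Proof. exact: size_poly. Qed.

Lemma antiderivK p : (antideriv p)^`() = p.
Proof.
apply/polyP => i; rewrite coef_deriv coef_antideriv /= -[LHS]mulr_natr divfK //.
Qed.

Fact antideriv_is_linear : linear antideriv.
Proof.
move=> t p q; apply/polyP => i.
by rewrite !(coefD, coefZ, coef_antideriv) mulrDl mulrA.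
Qed.

HB.instance Definition _ :=
  GRing.isLinear.Build R {poly R} {poly R} *:%R antideriv antideriv_is_linear.

(** The integral over [[a, b]] in algebraic form: linear in [p] and additive in the interval without
    integrability conditions. [integral_horner] identifies it with the Lebesgue integral. *)
Definition intp a b p : R := (antideriv p).[b] - (antideriv p).[a].

Fact intp_is_linear a b : linear_for *%R (intp a b).
Proof. by move=> t p q; rewrite /intp antideriv_is_linear !hornerE /=; ring. Qed.

HB.instance Definition _ a b :=
  GRing.isLinear.Build R {poly R} R *%R (intp a b) (intp_is_linear a b).

Lemma intp_id a p : intp a a p = 0.
Proof. exact: subrr. Qed.

Lemma intpB a b p q : intp a b (p - q) = intp a b p - intp a b q.
Proof. exact: linearB. Qed.

Lemma intpD a b c p : intp a b p + intp b c p = intp a c p.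
Proof. by rewrite /intp; ring. Qed.

Lemma size_deriv_le p n : (size p <= n.+1)%N -> (size p^`() <= n)%N.
Proof.
have [->|pn0] := eqVneq p 0; first by rewrite linear0 size_poly0.
by move=> sp; rewrite -ltnS (leq_trans (lt_size_deriv pn0)).
Qed.

Lemma size_antiderivDC p (t : R) n : (size p <= n)%N ->
  (size (antideriv p + t%:P)%R <= n.+1)%N.
Proof.
move=> sp; rewrite (leq_trans (size_polyD _ _)) // geq_max.
rewrite (leq_trans (size_antideriv _)) //.
by rewrite (leq_trans (size_polyC_leq1 _)).
Qed.

Lemma deriv_eq0 p : p^`() = 0 -> p = (p`_0)%:P.
Proof.
move=> p'0; apply/polyP => -[|i]; rewrite coefC //=.
have /eqP := congr1 (fun q : {poly R} => q`_i) p'0.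
by rewrite coef_deriv coef0 mulrn_eq0 /= => /eqP.
Qed.

Lemma intp_deriv a b p : intp a b p^`() = p.[b] - p.[a].
Proof.
have /deriv_eq0 e : (antideriv p^`() - p)^`() = 0.
  by rewrite derivB antiderivK subrr.
rewrite /intp -(subrK p (antideriv p^`())) e !hornerE.
ring.
Qed.

Lemma poly_eq0_itv a b p : a < b -> (forall x, x \in `[a, b] -> p.[x] = 0) ->
  p = 0.
Proof.
move=> ab p0; apply/eqP/negPn/negP => pn0.
(* These [size p] points are pairwise distinct and lie in []a, b]]: one root more than the degree of
   a nonzero [p] allows. *)
pose f (i : nat) := a + (b - a) / i.+1%:R.
pose rs := [seq f i | i <- iota 0 (size p)].
have := max_poly_roots (rs := rs) pn0; rewrite size_map size_iota ltnn.
suff [-> ->] : all (root p) rs /\ uniq rs by move=> /(_ isT isT).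
split.
  apply/allP => _ /mapP[i _ ->]; apply/rootP/p0; rewrite in_itv /= /f.
  rewrite lerDl divr_ge0 ?subr_ge0 ?(ltW ab) //= addrC -lerBrDr.
  rewrite ler_pdivrMr ?ltr0n // ler_peMr ?subr_ge0 ?(ltW ab) //.
  by rewrite ler1n.
rewrite map_inj_uniq ?iota_uniq // => i j /addrI /mulfI.
rewrite subr_eq0 gt_eqF // => /(_ isT) /invr_inj /eqP.
by rewrite eqr_nat eqSS => /eqP.
Qed.

(** The antiderivative of the square is nondecreasing with equal values at [a] and [b], so it is
    constant on the interval, hence constant as a polynomial. *)
Lemma intp_sqr_eq0 a b p : a < b -> intp a b (p * p) = 0 -> p = 0.
Proof.
move=> ab; set P := antideriv (p * p) => /subr0_eq Pab.
have P'E : P^`() = p * p by exact: antiderivK.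
have mono : {in `[a, b] &, {homo horner P : x y / x <= y}}.
  by apply: polyrcf.ler_hornerW => x _; rewrite P'E hornerM -expr2 sqr_ge0.
have /eqP : P - (P.[a])%:P = 0.
  apply: (poly_eq0_itv ab) => x xab; rewrite !hornerE; apply/eqP.
  have [ax xb] : a <= x /\ x <= b by move: xab; rewrite in_itv => /andP[].
  rewrite subr_eq0 eq_le [P.[a] <= _]mono ?in_itv /= ?lexx ?(ltW ab) ?ax //.
  by rewrite -Pab mono ?in_itv /= ?lexx ?(ltW ab) ?ax.
rewrite subr_eq0 => /eqP PE; move: P'E; rewrite PE derivC => /esym/eqP.
by rewrite mulf_eq0 orbb => /eqP.
Qed.

(* The Gram matrix of the monomials is positive definite, hence invertible. *)
Lemma intp_riesz (k : nat) a b (l : {scalar {poly R}}) : a < b ->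
  exists2 g : {poly R}, (size g <= k.+1)%N &
    forall q : {poly R}, (size q <= k.+1)%N -> intp a b (g * q) = l q.
Proof.
move=> ab; pose G : 'M[R]_k.+1 := \matrix_(i, j) intp a b ('X^i * 'X^j).
have GE (u : 'rV[R]_k.+1) j : (u *m G) 0 j = intp a b (rVpoly u * 'X^j).
  rewrite mxE /rVpoly poly_def mulr_suml linear_sum.
  apply: eq_bigr => i _ /=; rewrite !mxE -scalerAl linearZ /=.
  by rewrite insubT // => lti; congr (u _ _ * _); apply/val_inj.
have decomp (q : {poly R}) : (size q <= k.+1)%N -> q = \sum_(j < k.+1) q`_j *: 'X^j.
  move=> sq; rewrite -poly_def; apply/polyP => i; rewrite coef_poly.
  by case: ltnP => // lei; rewrite nth_default // (leq_trans sq).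
(* A linear form on degree at most [k] is determined by the monomials. This serves twice: with the
   zero form for the kernel of [G], and with [l] at the end. *)
have ext (g : {poly R}) (f : {scalar {poly R}}) (q : {poly R}) :
    (size q <= k.+1)%N ->
    (forall j : 'I_k.+1, intp a b (g * 'X^j) = f 'X^j) -> intp a b (g * q) = f q.
  move=> sq h; rewrite (decomp _ sq) mulr_sumr !linear_sum.
  by apply: eq_bigr => j _; rewrite -scalerAr !linearZ /= h.
have Gu : G \in unitmx.
  (* A row in the left kernel of [G] is the coefficient vector of a polynomial orthogonal to every
     monomial, hence to itself. *)
  rewrite -row_free_unit -kermx_eq0; apply/eqP/row_matrixP => i.
  rewrite row0; set u := row i _.
  have uG : u *m G = 0 by apply/sub_kermxP; exact: row_sub.
  rewrite -(rVpolyK u); suff -> : rVpoly u = 0 by rewrite linear0.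
  apply: (intp_sqr_eq0 ab).
  have := ext (rVpoly u) \0 _ (size_poly _ _); rewrite /rVpoly; apply => j.
  by rewrite -/(rVpoly u) -GE uG mxE.
pose v : 'rV[R]_k.+1 := \row_j l 'X^j.
exists (rVpoly (v *m invmx G)); first exact: size_poly.
move=> q sq; apply: (ext) => // j.
by rewrite -GE mulmxKV // mxE.
Qed.

End PolynomialIntegral.

(** * Lebesgue integrals of functions that agree almost everywhere with polynomials *)

Section AlmostEverywherePolynomial.
Context {R : realType}.
Local Notation mu := (@lebesgue_measure R).
Implicit Types (p q : {poly R}) (a b c x : R) (z : R -> R).

Lemma ae_impl (P Q : R -> Prop) : (forall x, P x -> Q x) ->
  {ae mu, forall x, P x} -> {ae mu, forall x, Q x}.
Proof.
by move=> PQ; apply: filterS PQ; exact: (ae_filter_ringOfSetsType mu).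
Qed.

Lemma ae_impl2 (P Q S : R -> Prop) : (forall x, P x -> Q x -> S x) ->
  {ae mu, forall x, P x} -> {ae mu, forall x, Q x} -> {ae mu, forall x, S x}.
Proof.
by move=> PQS; apply: filterS2 PQS; exact: (ae_filter_ringOfSetsType mu).
Qed.

(** A finite intersection of conull sets is conull, by induction along the enumeration of [I]. *)
Lemma ae_forall (I : finType) (P : I -> R -> Prop) :
  (forall i, {ae mu, forall x, P i x}) -> {ae mu, forall x, forall i, P i x}.
Proof.
move=> h; suff: {ae mu, forall x, forall i, i \in enum I -> P i x}.
  by apply: ae_impl => x hx i; apply: hx; rewrite mem_enum.
elim: (enum I) => [|i s IHs]; first exact: aeW.
apply: (ae_impl2 _ (h i) IHs) => x Pi Ps j.
by rewrite in_cons => /predU1P[->|/Ps].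
Qed.

Lemma integrable_horner a b p :
  mu.-integrable `[a, b] (EFin \o horner p).
Proof.
apply: continuous_compact_integrable; first exact: segment_compact.
by apply: continuous_subspaceT => x; exact: continuous_horner.
Qed.

Lemma integral_horner a b p : a <= b ->
  (\int[mu]_(x in `[a, b]) (p.[x])%:E = (intp a b p)%:E)%E.
Proof.
(* The fundamental theorem of calculus is applied for [a < b] only; the one-point interval is
   settled directly. *)
rewrite le_eqVlt => /predU1P[->|ab].
  by rewrite set_itv1 integral_set1 intp_id.
rewrite (@continuous_FTC2 _ _ (horner (antideriv p))) //.
- by apply: continuous_subspaceT => x; exact: continuous_horner.
- split; first by move=> x _; exact: derivable_horner.
  + by apply: cvg_at_right_filter; exact: continuous_horner.
  + by apply: cvg_at_left_filter; exact: continuous_horner.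
- by move=> x _; rewrite -derivE antiderivK.
Qed.

Definition ae_on a b z z' :=
  {ae mu, forall x : R, x \in `[a, b] -> z x = z' x}.

Lemma ae_on_sub a b a' b' z z' : a <= a' -> b' <= b ->
  ae_on a b z z' -> ae_on a' b' z z'.
Proof.
move=> aa' bb'; apply: ae_impl => x h; rewrite in_itv /= => /andP[ax xb]; apply: h.
by rewrite in_itv /= (le_trans aa') // (le_trans xb).
Qed.

Lemma integral_ae_horner a b z p : a <= b ->
  measurable_fun setT z -> ae_on a b z (horner p) ->
  (\int[mu]_(x in `[a, b]) (z x)%:E = (intp a b p)%:E)%E.
Proof.
move=> ab mz zp; rewrite -integral_horner //.
apply: ae_eq_integral => //.
- by apply/measurable_EFinP; exact: measurable_funTS.
- by have /integrableP[] := integrable_horner a b p.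
- by apply: ae_impl zp => x /= h xab; rewrite h.
Qed.

Lemma Rintegral_ae_horner a b z p : a <= b ->
  measurable_fun setT z -> ae_on a b z (horner p) ->
  \int[mu]_(x in `[a, b]) z x = intp a b p.
Proof. by move=> ab mz zp; rewrite /Rintegral (integral_ae_horner ab mz zp). Qed.

Lemma Rintegral_ae_horner2 a b c z p q : a <= c -> c <= b ->
  measurable_fun setT z ->
  ae_on a c z (horner p) -> ae_on c b z (horner q) ->
  \int[mu]_(x in `[a, b]) z x = intp a c p + intp c b q.
Proof.
move=> ac cb mz zp zq.
have mE (D : set R) : measurable_fun D (EFin \o z).
  by apply: measurable_funTS; exact/measurable_EFinP.
(* The right piece is taken open at [c] to make the union disjoint; closing it again later costs
   only a null point. *)
have -> : `[a, b]%classic = `[a, c] `|` `]c, b].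
  by rewrite -itv_bndbnd_setU ?bnd_simp.
have disj : [disjoint `[a, c]%classic & `]c, b]%classic].
  apply/disj_set2P; rewrite -subset0 => x /=.
  by rewrite !in_itv /= => -[/andP[_ xc]]; rewrite ltNge xc.
have iL := integral_ae_horner ac mz zp.
have iR : (\int[mu]_(x in `]c, b]) (z x)%:E = (intp c b q)%:E)%E.
  by apply: etrans (integral_ae_horner cb mz zq); exact: integral_itv_obnd_cbnd.
apply: etrans (congr1 fine (integral_setU mu _ _ (mE _) disj)) _ => //.
by apply: (congr1 fine (x := (_ + _)%E) (y := (_ + _)%:E)); rewrite EFinD -iL -iR.
Qed.

(** The squared norm is at most the integral of [p * p] over the closed interval, which is finite.
    The flags [s] and [t] cover the closed and half-open pieces used to build a two-piece
    function. *)
Lemma Lfun_itv_horner a b p (s t : bool) :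
  (horner p) \_ [set` Interval (BSide s a) (BSide t b)] \in Lfun mu 2%:E.
Proof.
set D := [set` _]; have mD : measurable D by exact: measurable_itv.
have mf : measurable_fun setT ((horner p) \_ D).
  by apply/(measurable_restrictT _ mD); exact: measurable_poly.
rewrite inE; apply/andP; split; rewrite inE /= //.
rewrite /finite_norm unlock /Lnorm; apply: poweR_lty.
have /integrableP[_] := integrable_horner a b (p * p).
apply: le_lt_trans.
have -> : (\int[mu]_x `|(EFin \o (horner p \_ D)) x| `^ 2 =
           \int[mu]_(x in D) `|(EFin \o horner (p * p)) x|)%E.
  rewrite [RHS]integral_mkcond; apply: eq_integral => x _ /=.
  rewrite !patchE; case: ifPn => _; rewrite /= ?normr0 ?powR0 //.
  by rewrite hornerM normrM -expr2 powR_mulrn.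
apply: ge0_subset_integral => //.
- by apply: measurableT_comp => //; apply/measurable_EFinP; exact: measurable_poly.
- by apply: subset_itv; rewrite bnd_simp; [case: (s)|case: (t)].
Qed.

Lemma Lfun2_measurable z : z \in Lfun mu 2%:E -> measurable_fun setT z.
Proof. by rewrite inE => /andP[]; rewrite inE. Qed.

End AlmostEverywherePolynomial.

(** * One cell [[a, b]] cut at [c]: two-piece functions, details and their primitives *)

Section Cell.
Context {R : realType} (k : nat) (a b c : R).
Hypotheses (ac : a < c) (cb : c < b).
Local Notation mu := (@lebesgue_measure R).
Implicit Types (p q pL pR : {poly R}) (x : R) (z : R -> R).

Definition piecewise z pL pR : Prop :=
  [/\ measurable_fun setT z, ae_on a c z (horner pL) & ae_on c b z (horner pR)].

(** The space Z_K in terms of pairs of polynomials, free of null sets. *)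
Definition detail pL pR : Prop :=
  [/\ (size pL <= k.+1)%N, (size pR <= k.+1)%N &
      forall q, (size q <= k.+1)%N -> intp a c (pL * q) + intp c b (pR * q) = 0].

(** The primitive, vanishing at [a], of the function with halves [pL] and [pR]. *)
Definition glued_primitive pL pR x : R :=
  if x <= c then intp a x pL else intp a c pL + intp c x pR.

Lemma glued_primitive_left pL pR x : x <= c ->
  glued_primitive pL pR x = (antideriv pL - (antideriv pL).[a]%:P).[x].
Proof. by rewrite /glued_primitive /intp => ->; rewrite !hornerE. Qed.

(** The formula reaches down to [c] itself because both branches agree there; so each closed half
    carries a single polynomial. *)
Lemma glued_primitive_right pL pR x : c <= x -> glued_primitive pL pR x =
  (antideriv pR + (intp a c pL - (antideriv pR).[c])%:P).[x].
Proof.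
rewrite /glued_primitive le_eqVlt => /predU1P[<-|cx].
  by rewrite lexx hornerD hornerC /intp; ring.
by rewrite leNgt cx /= hornerD hornerC /intp; ring.
Qed.

Lemma glued_primitive_sum (I : finType) (t : I -> R) (PL PR : I -> {poly R}) x :
  \sum_i t i * glued_primitive (PL i) (PR i) x =
  glued_primitive (\sum_i t i *: PL i) (\sum_i t i *: PR i) x.
Proof.
rewrite /glued_primitive; case: ifP => _.
  by rewrite linear_sum; apply: eq_bigr => i _; rewrite linearZ.
rewrite !linear_sum -big_split; apply: eq_bigr => i _.
by rewrite mulrDr !linearZ.
Qed.

Lemma primitive_on_piecewise z pL pR x : piecewise z pL pR -> x \in `[a, b] ->
  primitive_on a b z x = glued_primitive pL pR x.
Proof.
move=> [mz zL zR] xab; rewrite /primitive_on xab /glued_primitive.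
move: xab; rewrite in_itv /= => /andP[ax xb].
have [xc|/ltW cx] := leP x c.
  by apply: Rintegral_ae_horner => //; apply: ae_on_sub zL.
apply: (Rintegral_ae_horner2 (ltW ac) cx mz zL).
by apply: ae_on_sub zR.
Qed.

Lemma piecewise_sum (I : finType) (t : I -> R) (z : I -> R -> R) PL PR :
  (forall i, piecewise (z i) (PL i) (PR i)) ->
  piecewise (fun x => \sum_i t i * z i x) (\sum_i t i *: PL i) (\sum_i t i *: PR i).
Proof.
move=> h; split.
- apply: measurable_sum => i; apply: measurable_funM => //.
  by have [] := h i.
- have /ae_forall : forall i, ae_on a c (z i) (horner (PL i)) by move=> i; have [] := h i.
  apply: ae_impl => x hx xac; rewrite horner_sum; apply: eq_bigr => i _.
  by rewrite hornerZ hx.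
- have /ae_forall : forall i, ae_on c b (z i) (horner (PR i)) by move=> i; have [] := h i.
  apply: ae_impl => x hx xac; rewrite horner_sum; apply: eq_bigr => i _.
  by rewrite hornerZ hx.
Qed.

Lemma piecewise_ae z z' pL pR : measurable_fun setT z' ->
  {ae mu, forall x, z' x = z x} -> piecewise z pL pR -> piecewise z' pL pR.
Proof.
move=> mz' zz' [_ zL zR]; split=> //.
- by apply: ae_impl2 zz' zL => x -> h /h.
- by apply: ae_impl2 zz' zR => x -> h /h.
Qed.

Lemma L2dot_piecewise z pL pR q : piecewise z pL pR ->
  L2dot a b z (horner q) = intp a c (pL * q) + intp c b (pR * q).
Proof.
move=> [mz zL zR]; apply: Rintegral_ae_horner2; try exact: ltW.
- by apply: measurable_funM => //; exact: measurable_poly.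
- by apply: ae_impl zL => x h /h ->; rewrite hornerM.
- by apply: ae_impl zR => x h /h ->; rewrite hornerM.
Qed.

Hypothesis (mid : (a + b) / 2 = c).

Lemma Zspace_piecewise z : Zspace k a b z ->
  exists P : {poly R} * {poly R}, piecewise z P.1 P.2 /\ detail P.1 P.2.
Proof.
rewrite /Zspace /= mid => -[[zL2 _] [pL sL zL] [pR sR zR] orth].
have zP : piecewise z pL pR by split=> //; exact: Lfun2_measurable zL2.
exists (pL, pR); split=> //; split=> // q sq.
by rewrite -(L2dot_piecewise q zP) orth.
Qed.

Lemma detail_Zspace pL pR : detail pL pR ->
  exists2 z, Zspace k a b z & piecewise z pL pR.
Proof.
move=> [sL sR orth].
(* The second piece is open at [c] so that the two terms never add up there. *)
pose z : R -> R := ((horner pL) \_ `[a, c]) + ((horner pR) \_ `]c, b]).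
have zE x : z x = (if x \in `[a, c] then pL.[x] else 0) + (if x \in `]c, b] then pR.[x] else 0).
  by rewrite /z fctE !patchE !mem_setE.
have zL2 : z \in Lfun mu 2%:E.
  have le12 : (1 <= 2%:E :> \bar R)%E by rewrite lee_fin ler1n.
  have [_ clD] := Lfun_addr_closed mu le12.
  by apply: clD; exact: Lfun_itv_horner.
have zP : piecewise z pL pR.
  split; first exact: Lfun2_measurable zL2.
    apply: aeW => x xac; rewrite zE xac.
    by move: xac; rewrite !in_itv /= => /andP[_ xc]; rewrite ltNge xc addr0.
  (* At [c] the function takes the value of [pL], which may differ from that of [pR]; the point is
     discarded as a null set. *)
  have : {ae mu, forall x, x != c}.
    exists [set c]; split => //; first by rewrite lebesgue_measure_set1.
    by move=> x /= /negP; rewrite negbK => /eqP.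
  apply: ae_impl => x xc; rewrite zE !in_itv /= => /andP[cx ->].
  have {}cx : c < x by rewrite lt_neqAle eq_sym xc.
  by rewrite (leNgt x) cx andbF add0r.
exists z => //; split.
- split=> // x; rewrite zE !in_itv /= => /negP xab.
  case: ifP => [/andP[ax xc]|_].
    by case: xab; rewrite ax (le_trans xc) ?ltW.
  case: ifP => [/andP[cx xb]|_]; last exact: addr0.
  by case: xab; rewrite xb andbT ltW // (lt_trans ac).
- by rewrite mid; exists pL => //; case: zP.
- by rewrite mid; exists pR => //; case: zP.
- by move=> q sq; rewrite (L2dot_piecewise q zP) orth.
Qed.

(** Orthogonality to the constant [1] makes the total integral vanish, so the primitive returns to
    zero at [b]. *)
Lemma primitive_on_endpoints z : Zspace k a b z ->
  primitive_on a b z a = 0 /\ primitive_on a b z b = 0.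
Proof.
move=> /Zspace_piecewise[[pL pR] [zP [_ _ orth]]].
have ab := lt_trans ac cb.
rewrite !(primitive_on_piecewise zP) ?in_itv /= ?lexx ?(ltW ab) //.
rewrite /glued_primitive (ltW ac) intp_id leNgt cb; split=> //=.
by have := orth 1; rewrite size_poly1 !mulr1; exact.
Qed.

Section Family.
Context (n : nat) (psi : 'I_n -> R -> R).
Hypothesis psiZ : forall r, Zspace k a b (psi r).

(** Integration turns the almost everywhere expansion of [z] into an identity at every point of the
    cell. *)
Lemma primitive_sum_detail (t : 'I_n -> R) z pL pR : measurable_fun setT z ->
  {ae mu, forall x, z x = \sum_r t r * psi r x} -> piecewise z pL pR ->
  forall x, x \in `[a, b] ->
    \sum_r t r * primitive_on a b (psi r) x = glued_primitive pL pR x.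
Proof.
move=> mz zpsi zP x xab.
have /choice[P PP] : forall r, exists P : {poly R} * {poly R}, piecewise (psi r) P.1 P.2.
  by move=> r; have /Zspace_piecewise[P []] := psiZ r; exists P.
rewrite -(primitive_on_piecewise zP xab).
(* [z] thus has two pairs of halves, the given one and the summed one; both primitives equal the
   integral of [z]. *)
have zP' := piecewise_ae mz zpsi (piecewise_sum t PP).
rewrite (primitive_on_piecewise zP' xab) -glued_primitive_sum.
by apply: eq_bigr => r _; rewrite (primitive_on_piecewise (PP r)).
Qed.

Lemma primitive_sum_poly_eq0 (t : 'I_n -> R) p : (size p <= k.+2)%N ->
  (forall x, x \in `[a, b] -> \sum_r t r * primitive_on a b (psi r) x = p.[x]) ->
  p = 0.
Proof.
move=> sp tp; have ab := lt_trans ac cb.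
have /choice[P PP] : forall r, exists P : {poly R} * {poly R},
    piecewise (psi r) P.1 P.2 /\ detail P.1 P.2.
  by move=> r; exact: Zspace_piecewise.
pose pL := \sum_r t r *: (P r).1; pose pR := \sum_r t r *: (P r).2.
have pE x : x \in `[a, b] -> p.[x] = glued_primitive pL pR x.
  move=> xab; rewrite -tp // -glued_primitive_sum; apply: eq_bigr => r _.
  by have [h _] := PP r; rewrite (primitive_on_piecewise h).
have orth q : (size q <= k.+1)%N -> intp a c (pL * q) + intp c b (pR * q) = 0.
  move=> sq; rewrite !mulr_suml !linear_sum -big_split big1 //= => r _.
  rewrite -!scalerAl !linearZ -mulrDr.
  by have [_ [_ _ ->//]] := PP r; rewrite mulr0.
(* On each half [p] agrees with an explicit polynomial on an interval of positive length, so they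
   coincide as polynomials and may be differentiated. *)
have p'L : p^`() = pL.
  rewrite -(antiderivK pL); apply/eqP; rewrite -subr_eq0; apply/eqP.
  have : p - (antideriv pL - (antideriv pL).[a]%:P) = 0.
    apply: (poly_eq0_itv ac) => x /[!in_itv] /= /andP[ax xc].
    rewrite hornerD hornerN -(glued_primitive_left pL pR xc) pE ?subrr //.
    by rewrite in_itv /= ax (le_trans xc (ltW cb)).
  by move=> /(congr1 (@deriv _)); rewrite !derivB derivC subr0 linear0.
have p'R : p^`() = pR.
  rewrite -(antiderivK pR); apply/eqP; rewrite -subr_eq0; apply/eqP.
  have : p - (antideriv pR + (intp a c pL - (antideriv pR).[c])%:P) = 0.
    apply: (poly_eq0_itv cb) => x /[!in_itv] /= /andP[cx xb].
    rewrite hornerD hornerN -(glued_primitive_right pL pR cx) pE ?subrr //.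
    by rewrite in_itv /= xb (le_trans (ltW ac) cx).
  by move=> /(congr1 (@deriv _)); rewrite derivB derivD derivC addr0 linear0.
have p'0 : p^`() = 0.
  apply: (intp_sqr_eq0 ab); rewrite -(intpD a c b) {1}p'L {2}p'R orth //.
  exact: size_deriv_le.
have pa : p.[a] = 0.
  rewrite pE ?in_itv /= ?lexx ?(ltW ab) // /glued_primitive (ltW ac).
  exact: intp_id.
by move: pa; rewrite (deriv_eq0 p'0) hornerC => ->.
Qed.

End Family.

Lemma split_detail (psi : 'I_k.+1 -> R -> R) pL pR :
  L2_orthonormal_basis a b (Zspace k a b) psi ->
  (size pL <= k.+1)%N -> (size pR <= k.+1)%N ->
  exists (t : 'I_k.+1 -> R) (g : {poly R}), (size g <= k.+1)%N /\
    forall x, x \in `[a, b] -> \sum_r t r * primitive_on a b (psi r) x =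
      glued_primitive (pL - g) (pR - g) x.
Proof.
move=> [psiZ _ gen] sL sR; have ab := lt_trans ac cb.
(* The pairing of the two-piece function with [q]; the polynomial [g] representing it is the
   projection of that function onto degree at most [k]. *)
pose l q := intp a c (pL * q) + intp c b (pR * q).
have l_lin : linear_for *%R l.
  move=> s u v; rewrite /l (mulrDr pL) (mulrDr pR) -!scalerAr !linearP /=.
  by ring.
pose lL := GRing.isLinear.Build R {poly R} R *%R l l_lin.
pose l' : {scalar {poly R}} := HB.pack l lL.
have [g sg gP] := intp_riesz k l' ab.
have sB (p : {poly R}) : (size p <= k.+1)%N -> (size (p - g)%R <= k.+1)%N.
  by move=> sp; rewrite (leq_trans (size_polyD _ _)) // geq_max sp size_polyN.
have [z zZ zP] : exists2 z, Zspace k a b z & piecewise z (pL - g) (pR - g).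
  apply: detail_Zspace; split; [exact: sB..|move=> q sq].
  (* The two integrals of [g * q] join into one over [[a, b]], which is [l q] by the choice of
     [g]. *)
  by rewrite !mulrBl !intpB addrACA -opprD intpD gP // subrr.
have [t zt] := gen z zZ.
exists t, g; split=> // x xab.
by apply: (primitive_sum_detail psiZ _ zt zP) xab; case: zP.
Qed.

Lemma split_cell (psi : 'I_k.+1 -> R -> R) (v : R -> R) pL pR :
  L2_orthonormal_basis a b (Zspace k a b) psi ->
  (size pL <= k.+2)%N -> (size pR <= k.+2)%N ->
  (forall x, x \in `[a, c] -> v x = pL.[x]) ->
  (forall x, x \in `[c, b] -> v x = pR.[x]) ->
  exists (t : 'I_k.+1 -> R) (p : {poly R}), (size p <= k.+2)%N /\
    forall x, x \in `[a, b] ->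
      v x - \sum_r t r * primitive_on a b (psi r) x = p.[x].
Proof.
move=> psib sL sR vL vR.
have [t [g [sg tE]]] := split_detail psib (size_deriv_le sL) (size_deriv_le sR).
(* What remains of [v] is the primitive of [g] whose value at [a] is that of [v]. *)
exists t, (antideriv g + (pL.[a] - (antideriv g).[a])%:P); split.
  exact: size_antiderivDC.
move=> x xab; rewrite tE // hornerD hornerC.
(* Both closed halves contain [c], so the pieces of [v] match there. *)
have pLc : pL.[c] = pR.[c] by rewrite -vL ?vR // in_itv /= lexx ltW.
move: xab; rewrite in_itv /glued_primitive /= => /andP[ax xb].
have [xc|/ltW cx] := leP x c; rewrite !intpB !intp_deriv.
  by rewrite vL ?in_itv /= ?ax // /intp; ring.
by rewrite pLc vR ?in_itv /= ?cx // /intp; ring.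
Qed.

End Cell.

(** * Dyadic nodes, the nesting of cells, and the spline spaces *)

Section Dyadic.
Context {R : realType}.
Implicit Types (m n r i j : nat) (x : R) (v : R -> R^o).

(** The index is a plain natural number, so adjacent cells share their nodes syntactically and the
    endpoint [2 ^ m] is included. *)
Definition node m n : R := n%:R / (2 ^ m)%:R.

Lemma cell_leftE m (j : 'I_(2 ^ m)) : cell_left j = node m j.
Proof. by []. Qed.

Lemma cell_rightE m (j : 'I_(2 ^ m)) : cell_right j = node m j.+1.
Proof. by []. Qed.

Lemma pow2_gt0 m : 0 < (2 ^ m)%:R :> R.
Proof. by rewrite ltr0n expn_gt0. Qed.

Lemma ler_node m i j : (node m i <= node m j) = (i <= j)%N.
Proof. by rewrite /node ler_pM2r ?invr_gt0 ?pow2_gt0 // ler_nat. Qed.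

Lemma ltr_node m i j : (node m i < node m j) = (i < j)%N.
Proof. by rewrite /node ltr_pM2r ?invr_gt0 ?pow2_gt0 // ltr_nat. Qed.

Lemma node0 m : node m 0 = 0.
Proof. exact: mul0r. Qed.

Lemma node_last m : node m (2 ^ m) = 1.
Proof. by rewrite /node divff // gt_eqF ?pow2_gt0. Qed.

Lemma node_double m n : node m.+1 n.*2 = node m n.
Proof.
by rewrite /node expnS -muln2 mulnC !natrM -mulf_div divff ?mul1r ?pnatr_eq0.
Qed.

Lemma node_mid m n : (node m n + node m n.+1) / 2 = node m.+1 n.*2.+1.
Proof.
rewrite /node -mulrDl -natrD addnS addnn expnS natrM -mulrA -invfM.
by rewrite [(2 ^ m)%:R * _]mulrC.
Qed.

Lemma exists_cell m n x : 0 <= x -> x <= node m n.+1 ->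
  exists2 i, (i <= n)%N & x \in `[node m i, node m i.+1].
Proof.
move=> x0; elim: n => [|n IHn] xn.
  by exists 0%N; rewrite // in_itv /= node0 x0.
have [/IHn[i /leqW le_in xi]|/ltW nx] := leP x (node m n.+1); first by exists i.
by exists n.+1; rewrite // in_itv /= nx.
Qed.

Lemma exists_cell01 m x : x \in `[0, 1] ->
  exists j : 'I_(2 ^ m), x \in `[cell_left j, cell_right j].
Proof.
rewrite in_itv /= -(node_last m) => /andP[x0 x1].
have N0 : (0 < 2 ^ m)%N by rewrite expn_gt0.
(* [exists_cell] expects the index of the right end as a successor. *)
rewrite -(prednK N0) in x1.
have [i lei xi] := exists_cell x0 x1.
have lti : (i < 2 ^ m)%N by rewrite -(prednK N0) ltnS.
by exists (Ordinal lti).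
Qed.

Lemma cell_sub01 m (j : 'I_(2 ^ m)) x :
  x \in `[cell_left j, cell_right j] -> x \in `[0 : R, 1].
Proof.
rewrite !in_itv /= => /andP[jx xj].
rewrite (le_trans _ jx) ?divr_ge0 //= (le_trans xj) //.
by rewrite -(node_last m) ler_node.
Qed.

Lemma continuous_within_poly a b v (p : {poly R}) :
  (forall x, x \in `[a, b] -> v x = p.[x]) ->
  {within `[a, b], continuous v}.
Proof.
move=> vp; apply: (@subspace_eq_continuous _ _ _ (horner p)).
  by move=> x; rewrite inE /= => xab; rewrite -vp.
by apply: continuous_subspaceT => x; exact: continuous_horner.
Qed.

(* The cells are closed and overlap at the nodes, so agreement with a
   polynomial on each of them already forces continuity. *)
Lemma spline_intro m r v : supported_in 0 1 v ->
  (forall j : 'I_(2 ^ m), exists2 p : {poly R}, (size p <= r.+1)%N &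
     forall x, x \in `[cell_left j, cell_right j] -> v x = p.[x]) ->
  spline m r v.
Proof.
move=> v0 vp; split=> //.
(* The interval grows by one cell at a time, and continuity is pasted along two closed sets. *)
suff h n : (n <= 2 ^ m)%N -> {within `[0, node m n], continuous v}.
  by rewrite -(node_last m); exact: h.
elim: n => [_|n IHn lt_n].
  by rewrite node0 set_itv1; exact: continuous_subspace1.
have -> : `[0, node m n.+1]%classic = `[0, node m n] `|` `[node m n, node m n.+1].
  apply/seteqP; split => x /=; rewrite !in_itv /=.
    by case/andP=> -> xn; have [xn'|/ltW ->] := leP x (node m n); [left|right].
  case=> /andP[x0 xn].
    by rewrite x0 (le_trans xn) // ler_node.
  by rewrite xn (le_trans _ x0) // -(node0 m) ler_node.
apply: withinU_continuous; [exact: itv_closed|exact: itv_closed|exact/IHn/ltnW|].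
have [p _ pE] := vp (Ordinal lt_n).
exact: continuous_within_poly pE.
Qed.

Lemma submod_closed_spline m r : submod_closed (mem (spline (R := R) m r)).
Proof.
split=> [|t u v]; rewrite ?inE.
  apply: spline_intro => // j; exists 0; first by rewrite size_poly0.
  by move=> x _; rewrite horner0.
move=> [u0 _ up] [v0 _ vp]; apply: spline_intro.
  by move=> x x01; rewrite !fctE u0 // v0 // scaler0 addr0.
move=> j; have [p sp pE] := up j; have [q sq qE] := vp j.
exists (t *: p + q).
  rewrite (leq_trans (size_polyD _ _)) // geq_max sq andbT.
  by rewrite (leq_trans (size_scale_leq _ _)).
by move=> x xj; rewrite !hornerE !fctE pE // qE.
Qed.

Lemma half_lt_pow2 m (i : 'I_(2 ^ m.+1)) : (i./2 < 2 ^ m)%N.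
Proof. by rewrite ltn_half_double -mul2n -expnS. Qed.

(** The parent of cell [i] has index [i./2], and the parity of [i] tells which half of the parent it
    is. *)
Lemma cell_half m (i : 'I_(2 ^ m.+1)) (j := Ordinal (half_lt_pow2 i)) x :
  x \in `[cell_left i, cell_right i] ->
  if odd i then x \in `[node m.+1 j.*2.+1, cell_right j]
  else x \in `[cell_left j, node m.+1 j.*2.+1].
Proof.
rewrite !cell_leftE !cell_rightE -(node_double m j) -(node_double m j.+1).
by have := odd_double_half i; case: odd => /= iE; rewrite -{1 2}iE.
Qed.

Lemma node_half_lt m j :
  node m j < node m.+1 j.*2.+1 /\ node m.+1 j.*2.+1 < node m j.+1.
Proof. by rewrite -(node_double m j) -(node_double m j.+1) !ltr_node doubleS. Qed.

Lemma cell_half_sub m (i : 'I_(2 ^ m.+1)) (j := Ordinal (half_lt_pow2 i)) x :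
  x \in `[cell_left i, cell_right i] -> x \in `[cell_left j, cell_right j].
Proof.
have [lt1 lt2] := node_half_lt m j.
move/cell_half; case: odd; rewrite !in_itv /= => /andP[h1 h2].
  by rewrite h2 (le_trans (ltW lt1)).
by rewrite h1 (le_trans h2) // ltW.
Qed.

Lemma spline_refine m r v : spline m r v -> spline m.+1 r v.
Proof.
move=> [v0 _ vp]; apply: spline_intro => // i.
have [p sp pE] := vp (Ordinal (half_lt_pow2 i)); exists p => // x /cell_half_sub.
exact: pE.
Qed.

Lemma spline_le m n r v : (m <= n)%N -> spline m r v -> spline n r v.
Proof.
move=> /subnKC <-; elim: (n - m)%N => [|d IHd]; first by rewrite addn0.
by rewrite addnS => /IHd; exact: spline_refine.
Qed.

End Dyadic.

Lemma submod_closed_sum (K : pzRingType) (V : lmodType K) (S : set V)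
    (I : finType) (t : I -> K) (F : I -> V) :
  submod_closed (mem S) -> (forall i, S (F i)) -> S (\sum_i t i *: F i).
Proof.
move=> [S0 SD] SF; suff : \sum_i t i *: F i \in mem S by rewrite inE.
by elim/big_rec: _ => // i v _ vS; apply: SD => //; rewrite inE.
Qed.

(** * The spaces spanned by the theta functions and the two-level splitting *)

Section Multiscale.
Context {R : realType} (k : nat).
Variable psi : forall m : nat, 'I_(2 ^ m.-1) -> 'I_k.+1 -> R -> R.
Hypothesis psi_basis : forall (m : nat) (j : 'I_(2 ^ m.-1)), (1 <= m)%N ->
  L2_orthonormal_basis (cell_left j) (cell_right j)
    (Zspace k (cell_left j) (cell_right j)) (psi j).
Implicit Types (m : nat) (x : R) (u v y : R -> R^o).

Lemma psiZ m (j : 'I_(2 ^ m)) r :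
  Zspace k (cell_left j) (cell_right j) (psi (m := m.+1) j r).
Proof. by have [] := psi_basis (m := m.+1) j isT. Qed.

(** Distinct closed cells meet at most in a common endpoint, where the primitive vanishes. *)
Lemma theta_other_cell m (i j : 'I_(2 ^ m)) r x :
  x \in `[cell_left i, cell_right i] -> j != i ->
  theta psi (m := m.+1) (j, r) x = 0.
Proof.
move=> xi ji; rewrite /theta /=.
have [lt1 lt2] := @node_half_lt R m j.
have [z0 z1] := primitive_on_endpoints lt1 lt2 (node_mid m j) (psiZ j r).
have [xj|/negPf xj] := boolP (x \in `[cell_left j, cell_right j]); last first.
  by rewrite /primitive_on xj.
move: xi xj; rewrite !in_itv /= => /andP[ix xi] /andP[jx xj].
move: ji; rewrite -val_eqE neq_ltn => /orP[ji|ij].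
  suff -> : x = cell_right j by [].
  by apply: le_anti; rewrite xj (le_trans _ ix) // ler_node.
suff -> : x = cell_left j by [].
by apply: le_anti; rewrite jx (le_trans xi) // ler_node.
Qed.

(** Localizes a combination over all cells to one cell, where the single-cell lemmas apply. *)
Lemma theta_sum_cell m (c : 'I_(2 ^ m) * 'I_k.+1 -> R) (i : 'I_(2 ^ m)) x :
  x \in `[cell_left i, cell_right i] ->
  (\sum_jr c jr *: theta psi (m := m.+1) jr) x =
  \sum_r c (i, r) * primitive_on (cell_left i) (cell_right i) (psi (m := m.+1) i r) x.
Proof.
move=> xi; rewrite fct_sumE.
rewrite (eq_bigr (fun jr => c (jr.1, jr.2) * theta psi (m := m.+1) (jr.1, jr.2) x)); last first.
  by move=> [].
rewrite -(pair_bigA _ (fun j r => c (j, r) * theta psi (m := m.+1) (j, r) x)) /=.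
rewrite (bigD1 i) //= [X in _ + X]big1 ?addr0 // => j ji.
by rewrite big1 // => r _; rewrite (theta_other_cell _ xi ji) mulr0.
Qed.

Lemma theta_spline m (jr : 'I_(2 ^ m) * 'I_k.+1) :
  spline m.+1 k.+1 (theta psi (m := m.+1) jr).
Proof.
case: jr => j r; apply: spline_intro => [x x01|i].
  rewrite /theta /primitive_on /=; case: ifP => // /cell_sub01.
  by rewrite (negPf x01).
(* On a fine cell whose parent is not [j] the function is zero; otherwise the parity of [i] below
   selects the half. *)
have [ij|ij] := eqVneq j (Ordinal (half_lt_pow2 i)); last first.
  exists 0 => [|x /cell_half_sub xi]; first by rewrite size_poly0.
  by rewrite (theta_other_cell _ xi) // horner0.
have [lt1 lt2] := @node_half_lt R m j.
have [[pL pR] /= [zP [sL sR _]]] := Zspace_piecewise lt1 lt2 (node_mid m j) (psiZ j r).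
have thetaE x : x \in `[cell_left i, cell_right i] ->
    theta psi (m := m.+1) (j, r) x = glued_primitive (cell_left j) (node m.+1 j.*2.+1) pL pR x.
  move=> /cell_half_sub; rewrite -ij => xj.
  exact: (primitive_on_piecewise lt1 zP xj).
have [io|ie] := boolP (odd i).
  exists (antideriv pR + (intp (cell_left j) (node m.+1 j.*2.+1) pL
      - (antideriv pR).[node m.+1 j.*2.+1])%:P); first exact: size_antiderivDC.
  move=> x xi; rewrite thetaE // glued_primitive_right //.
  by move/cell_half: xi; rewrite io -ij in_itv => /andP[].
exists (antideriv pL + (- (antideriv pL).[cell_left j])%:P); first exact: size_antiderivDC.
move=> x xi; rewrite thetaE // glued_primitive_left ?polyCN //.
by move/cell_half: xi; rewrite (negPf ie) -ij in_itv => /andP[].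
Qed.

Lemma Yspace_spline m : Yspace psi m `<=` spline m k.+1.
Proof.
case: m => [|m] //= y [c ->].
by apply: submod_closed_sum (submod_closed_spline _ _) _ => jr; exact: theta_spline.
Qed.

Lemma split_spline m v : spline m.+1 k.+1 v ->
  exists u y, [/\ spline m k.+1 u, Yspace psi m.+1 y & v = u + y].
Proof.
move=> [v0 vc vp].
have H (j : 'I_(2 ^ m)) : exists tp : ('I_k.+1 -> R) * {poly R},
    (size tp.2 <= k.+2)%N /\ forall x, x \in `[cell_left j, cell_right j] ->
    v x - \sum_r tp.1 r *
      primitive_on (cell_left j) (cell_right j) (psi (m := m.+1) j r) x =
    tp.2.[x].
  have [lt1 lt2] := @node_half_lt R m j.
  (* The halves of cell [j] are the fine cells [j.*2] and [j.*2.+1]. *)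
  have lt2j : (j.*2.+1 < 2 ^ m.+1)%N.
    by rewrite expnS mul2n ltn_Sdouble.
  have [pL sL vL] := vp (Ordinal (ltnW lt2j)).
  have [pR sR vR] := vp (Ordinal lt2j).
  have vL' x : x \in `[cell_left j, node m.+1 j.*2.+1] -> v x = pL.[x].
    by rewrite cell_leftE -(node_double m j); exact: vL.
  have vR' x : x \in `[node m.+1 j.*2.+1, cell_right j] -> v x = pR.[x].
    by rewrite cell_rightE -(node_double m j.+1); exact: vR.
  have [t [p [sp tE]]] := split_cell lt1 lt2 (node_mid m j)
    (psi_basis (m := m.+1) j isT) sL sR vL' vR'.
  by exists (t, p).
(* The cellwise coefficients, chosen simultaneously, become one family indexed by cell and basis
   function. *)
have [tp tpE] := choice H.
pose c (jr : 'I_(2 ^ m) * 'I_k.+1) := (tp jr.1).1 jr.2.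
pose y := \sum_jr c jr *: theta psi (m := m.+1) jr.
have yY : Yspace psi m.+1 y by exists c.
exists (v - y), y; split=> //; last by rewrite subrK.
(* Only the support and one polynomial per coarse cell have to be checked for [v - y]. *)
apply: spline_intro => [x x01|j].
  have [y0 _ _] := Yspace_spline yY.
  by rewrite !fctE v0 // y0 // subr0.
have [sp pE] := tpE j; exists (tp j).2 => // x xj.
by rewrite !fctE -pE // /y (theta_sum_cell _ xj).
Qed.

(** S_m and Y_(m+1) meet trivially: on each coarse cell [y] is one polynomial and also a combination
    of primitives of details. *)
Lemma spline_Yspace_eq0 m y : spline m k.+1 y -> Yspace psi m.+1 y -> y = 0.
Proof.
move=> [y0 _ yp] [c yE]; apply/funext => x.
have [/exists_cell01 -/(_ m)[j xj]|/y0//] := boolP (x \in `[0 : R, 1]).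
have [p sp pE] := yp j.
have [lt1 lt2] := @node_half_lt R m j.
rewrite pE // (primitive_sum_poly_eq0 lt1 lt2 (node_mid m j) (psiZ j)
  (t := fun r => c (j, r)) sp) ?horner0 //.
by move=> x' xj'; rewrite -pE // yE (theta_sum_cell _ xj').
Qed.

Lemma submod_closed_Yspace m : submod_closed (mem (Yspace psi m)).
Proof.
case: m => [|m]; first exact: submod_closed_spline.
split=> [|t u v]; rewrite ?inE.
  by exists (fun=> 0); rewrite big1 // => i _; rewrite scale0r.
move=> [c ->] [d ->]; exists (fun i => t * c i + d i).
rewrite scaler_sumr -big_split; apply: eq_bigr => i _.
by rewrite /= scalerDl scalerA.
Qed.

Lemma spline_sum L (w : 'I_L.+1 -> R -> R^o) :
  (forall i : 'I_L.+1, Yspace psi i (w i)) -> spline L k.+1 (\sum_i w i).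
Proof.
move=> wY; have cl := submod_closed_spline (R := R) L k.+1.
have -> : \sum_i w i = \sum_i 1 *: w i.
  by apply: eq_bigr => i _; rewrite scale1r.
apply: (submod_closed_sum _ cl) => i.
by apply: spline_le (Yspace_spline (wY i)); rewrite -ltnS.
Qed.

Lemma spline_decomposition L v : spline L k.+1 v ->
  exists2 w : nat -> R -> R^o, forall i, Yspace psi i (w i) &
    v = \sum_(i < L.+1) w i.
Proof.
have Y0 i : Yspace psi i 0 by have [] := submod_closed_Yspace i; rewrite inE.
elim: L v => [|L IHL] v vS.
  (* Indexing [w] by all naturals avoids casts between ordinals; above the current level it is
     padded with zero, which lies in every [Yspace]. *)
  by exists (fun i => if i == 0%N then v else 0) => [[|i]//|]; rewrite big_ord1.
have [u [y [/IHL[w wY ->] yY ->]]] := split_spline vS.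
exists (fun i => if i == L.+1 then y else w i) => [i|].
  by have [->|_] := eqVneq i L.+1.
rewrite [RHS]big_ord_recr /= eqxx; congr (_ + _); apply: eq_bigr => i _.
by rewrite ltn_eqF.
Qed.

(** The top term is minus the sum of the lower ones, hence lies in S_L as well as in Y_(L+1) and
    vanishes; induction handles the rest. *)
Lemma Yspace_independent L (w : 'I_L.+1 -> R -> R^o) :
  (forall i : 'I_L.+1, Yspace psi i (w i)) -> \sum_i w i = 0 -> forall i, w i = 0.
Proof.
elim: L w => [|L IHL] w wY; first by rewrite big_ord1 => w0 i; rewrite ord1.
rewrite big_ord_recr /= => w0.
have lowS := spline_sum (w := fun i => w (widen_ord (leqnSn _) i)) (fun i => wY _).
have wmax : w ord_max = 0.
  apply: (spline_Yspace_eq0 _ (wY ord_max)).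
  (* Written in the shape [t *: u + v] that [submod_closed] accepts. *)
  have -> : w ord_max = - 1 *: (\sum_(i < L.+1) w (widen_ord (leqnSn _) i)) + 0.
    by rewrite addr0 scaleN1r; apply/eqP; rewrite -addr_eq0 addrC w0.
  have [s0 sD] := submod_closed_spline (R := R) L k.+1.
  by have := sD (-1) _ 0 (mem_set lowS) s0; rewrite inE.
rewrite wmax addr0 in w0 => i.
case: (unliftP ord_max i) => [j|] -> //.
have -> : lift ord_max j = widen_ord (leqnSn _) j by apply: val_inj; exact: lift_max.
exact: (IHL (fun i => w (widen_ord (leqnSn _) i)) (fun i => wY _) w0 j).
Qed.

End Multiscale.

Theorem lemma2p1 (R : realType) (k : nat)
    (psi : forall m : nat, 'I_(2 ^ m.-1) -> 'I_k.+1 -> R -> R)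
    (psi_basis : forall (m : nat) (j : 'I_(2 ^ m.-1)), (1 <= m)%N ->
       L2_orthonormal_basis (cell_left j) (cell_right j)
         (Zspace k (cell_left j) (cell_right j)) (psi m j))
    (L : nat) :
  is_direct_sum (spline L k.+1) (fun m : 'I_L.+1 => Yspace psi m).
Proof.
split=> [i||w wY w0].
- exact: submod_closed_Yspace.
- apply/seteqP; split=> [v /(spline_decomposition psi_basis)[w wY ->]|_ [w wY ->]].
    by exists (fun i : 'I_L.+1 => w i).
  exact: (spline_sum psi_basis wY).
- exact: (Yspace_independent psi_basis wY w0).
Qed.
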